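(* Let $X$ be a locally compact Hausdorff space, and let $A\subseteq X$ be a regular closed, $\sigma$-compact, non-compact, metrizable subset. If $\{\operatorname{Homeo}_K(X)\}_{K\in\mathscr K(X)}$ satisfies ACP, then at least one of the following holds: (i) $\operatorname{Homeo}_M(X)$ is locally compact for every compact metrizable subset $M\subseteq X$; or (ii) there is a regular closed compact $K_0\subseteq A$ such that (1) for every compact $K\subseteq A$ with $K_0\subseteq K$, the subset $\operatorname{Homeo}_{K_0}(X)$ is open in $\operatorname{Homeo}_K(X)$; and (2) for every compact $C\subseteq\overline{A\setminus K_0}$, the group $\operatorname{Homeo}_C(X)$ is discrete.
   Context: A subset is regular closed if it equals the closure of its interior. For a compact $K\subseteq X$, $\operatorname{Homeo}_K(X)$ is the group of homeomorphisms of $X$ fixing every point of $X\setminus K$, with the compact-open topology (a topological group). $\mathscr K(X)$ is the set of compact subsets of $X$ ordered by inclusion, with inclusions as bonding maps. For a directed family $\{G_\alpha\}$ of topological groups with inclusions that are closed embeddings as bonding maps and union $G$, the colimit space topology is $\mathscr T=\{U\subseteq G\mid U\cap G_\alpha\text{ open in }G_\alpha\ \forall\alpha\}$; the family satisfies ACP if $(G,\mathscr T)$ is a topological group (equivalently, $\mathscr T$ equals the finest group topology making all inclusions continuous). *)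

(* Defs.v *)
From HB Require Import structures.
From mathcomp Require Import all_boot all_order all_algebra.
From mathcomp Require Import all_classical all_reals all_analysis.
From mathcomp Require Import Rstruct Rstruct_topology.
From Stdlib Require Import Rdefinitions.

Set Implicit Arguments.
Unset Strict Implicit.
Unset Printing Implicit Defensive.

Import Order.TTheory GRing.Theory Num.Theory.
Local Open Scope classical_set_scope.
Local Open Scope ring_scope.

Section Defs.
Context {X : topologicalType}.

Definition regular_closed (A : set X) : Prop := A = closure (A°).

Definition sigma_compact (A : set X) : Prop :=
  exists K : nat -> set X, (forall n, compact (K n)) /\ A = \bigcup_n K n.

Definition metrizable_set (A : set X) : Prop :=
  exists d : X -> X -> Rdefinitions.R,
    [/\ (forall x y, A x -> A y -> 0 <= d x y),
        (forall x y, A x -> A y -> (d x y = 0 <-> x = y)),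
        (forall x y, A x -> A y -> d x y = d y x),
        (forall x y z, A x -> A y -> A z -> d x z <= d x y + d y z) &
        (forall U : set X, U `<=` A ->
           ((exists V : set X, open V /\ U = V `&` A) <->
            (forall x, U x -> exists e : Rdefinitions.R,
                0 < e /\ [set y | A y /\ d x y < e] `<=` U)))].

Definition homeo (f : X -> X) : Prop :=
  exists g : X -> X, [/\ cancel f g, cancel g f, continuous f & continuous g].

(* Homeo_K(X), as a subset of the space of maps X -> X carrying the
   compact-open topology; it is given the subspace topology via set_type. *)
Definition HomeoK (K : set X) : set (@compact_open X X) :=
  [set f | homeo f /\ forall x, ~ K x -> f x = x].

Definition Homeo_c : set (X -> X) :=
  [set f | exists K : set X, compact K /\ HomeoK K f].

Definition colim_open (U : set (X -> X)) : Prop :=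
  U `<=` Homeo_c /\
  forall K : set X, compact K ->
    open [set f : set_type (HomeoK K) | U (set_val f)].

(* ACP for the family {Homeo_K(X)}_{K in K(X)}: (G, colimit topology) is a
   topological group (group law: composition; inverse: inverse map). *)
Definition ACP_Homeo : Prop :=
  (forall f g : X -> X, Homeo_c f -> Homeo_c g ->
     forall W, colim_open W -> W (f \o g) ->
     exists U V : set (X -> X),
       [/\ colim_open U, colim_open V, U f, V g &
           forall u v, U u -> V v -> W (u \o v)]) /\
  (forall W, colim_open W ->
     colim_open [set g | Homeo_c g /\ exists h, W h /\ forall x, h (g x) = x]).

End Defs.

Definition discrete_top (T : topologicalType) : Prop :=
  forall x : T, open [set x].

(* Main.v *)
(** Yamasaki's argument. Exhaust A by regular closed compact sets K_n. If
    Homeo_M(X) is not locally compact, then, being second countable, it has in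
    each member of a neighborhood base at the identity a sequence x_{n,k} (k in N)
    without cluster point. If moreover for every n some Homeo_{K_m}(X), m >= n,
    does not have Homeo_{K_n}(X) as an open subgroup, there are h_{n,k} in
    Homeo_{K_m}(X) outside of Homeo_{K_n}(X) that tend to the identity as k grows.
    Any Homeo_C(X) meets only finitely many of the sequences x_{n,k} h_{n,k}^-1,
    and these have no cluster point either, so that their union over large n is
    closed in the colimit topology and misses the identity. But every product U V
    of neighborhoods of the identity contains some x_{n,k} h_{n,k}^-1,
    contradicting ACP. Hence some K_0 = K_n satisfies (1). For (2), an element of
    Homeo_C(X) close to the identity lies in Homeo_{K_0}(X); it is then supported
    in the frontier of K_0, so it is the identity. *)
Require Import Defs.
From HB Require Import structures.
From mathcomp Require Import all_boot all_order all_algebra.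
From mathcomp Require Import all_classical all_reals all_analysis.
From mathcomp Require Import Rstruct.

Set Implicit Arguments.
Unset Strict Implicit.
Unset Printing Implicit Defensive.

Import Order.TTheory GRing.Theory Num.Theory.

Local Open Scope classical_set_scope.

(** * Compact sets: finite covers, neighborhoods, countable bases *)

Section Topology.
Context {X : topologicalType}.

(** Near-covering compactness is applied to the filter of finite lists ordered by inclusion: around
    [x], every list containing a suitable [i] already covers the neighborhood [P i]. *)
Lemma compact_seq_cover (I : eqType) (K : set X) (P : I -> set X) :
  compact K -> (forall x, K x -> exists i, nbhs x (P i)) ->
  exists s : seq I, forall x, K x -> exists2 i, i \in s & P i x.
Proof.
move=> /compact_near_coveringP cK cov.
pose F := filter_from [set: seq I] (fun s0 => [set s : seq I | {subset s0 <= s}]).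
have FF : Filter F.
  apply: filter_from_filter; first by exists [::].
  move=> s t _ _; exists (s ++ t) => // u /= stu.
  by split=> i si; apply: stu; rewrite mem_cat si ?orbT.
have [|s _ sF] := cK _ F (fun s x => exists2 i, i \in s & P i x) FF.
  move=> x /cov[i Pi]; exists (P i, [set s | i \in s]).
    by split=> //; exists [:: i] => // s; apply; rewrite mem_head.
  by move=> [y s] /= [Piy si]; exists i.
by exists s => x Kx; apply: (sF s).
Qed.

(** Regularity gives each point of [K] a compact closed neighborhood inside [U]. Finitely many of
    their interiors cover [K]; [O] is the interior of the union [C] of these neighborhoods. *)
Lemma compact_nbhd (K U : set X) : locally_compact [set: X] ->
  hausdorff_space X -> compact K -> open U -> K `<=` U ->
  exists O, [/\ open O, K `<=` O, closure O `<=` U & compact (closure O)].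
Proof.
move=> lcX hX cK oU KU.
have [|s sK] := @compact_seq_cover _ K
    (fun N : set X => [set x | [/\ N x, compact N, closed N & N `<=` U]]°) cK.
  move=> x Kx; have [V nV [cV clV]] := lcX x I.
  have {}nV : nbhs x V.
    by apply: (@filterS _ (nbhs x) _ [set y | setT y -> V y]) nV => y; exact.
  have [] := @compact_regular _ x V hX cV nV U.
    by apply: open_nbhs_nbhs; split=> //; exact: KU.
  move=> N nN NU; exists (V `&` closure N); apply: nbhs_interior.
  have : nbhs x (V `&` closure N).
    by apply: filterI => //; apply: filterS nN; exact: subset_closure.
  apply: filterS => y VNy; split=> //.
  - by apply: compact_closedI => //; exact: closed_closure.
  - by apply: closedI => //; exact: closed_closure.
  - by move=> z [_ /NU].
pose good (N : set X) := [/\ compact N, closed N & N `<=` U].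
pose C := \big[setU/set0]_(N <- s | `[< good N >]) N.
have CE x : C x <-> exists N, [/\ N \in s, good N & N x].
  rewrite /C -bigcup_seq_cond; split.
    by case=> N /= /andP[Ns /asboolP gN] Nx; exists N.
  by case=> N [Ns gN Nx]; exists N => //=; rewrite Ns; exact/asboolP.
have cC : compact C by apply: bigsetU_compact => N /asboolP[].
have clC : closed C by exact: compact_closed.
have OC : closure C° `<=` C.
  rewrite [X in _ `<=` X](closure_id C).1 //.
  by apply: closureS; exact: interior_subset.
exists C°; split.
- exact: open_interior.
- move=> x /sK[N Ns]; apply: filterS => y [Ny cN clN NU].
  by apply/CE; exists N.
- by move=> x /OC /CE[N [_ [_ _ NU] /NU]].
- by apply: subclosed_compact OC => //; exact: closed_closure.
Qed.

Local Open Scope ring_scope.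

(** For every [n], finitely many balls of radius 1/(n+1) cover [M]. The metric lives on [A] only, so
    each ball is replaced by an open set of X with trace on [A] inside the ball. *)
Lemma metrizable_compact_base (A M : set X) :
  metrizable_set A -> compact M -> M `<=` A ->
  exists B : nat -> set X, (forall i, open (B i)) /\
    forall p U, M p -> nbhs p U -> exists i, B i p /\ B i `&` M `<=` U.
Proof.
move=> [d [d0 dE dC dT dO]] cM MA.
have exV (nx : nat * X) : exists V : set X, [/\ open V,
    (forall y, A y -> V y -> A nx.2 /\ d nx.2 y < nx.1.+1%:R^-1)
    & A nx.2 -> V nx.2].
  case: nx => n x /=; have [Ax|nAx] := pselect (A x); last first.
    by exists set0; split=> //; exact: open0.
  have [|_ ballV] := dO [set y | A y /\ d x y < n.+1%:R^-1]; first by move=> y [].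
  have {ballV} [|V [oV VE]] := ballV.
    move=> y [Ay dxy]; exists (n.+1%:R^-1 - d x y); split; first by rewrite subr_gt0.
    move=> z [Az dyz]; split=> //; apply: le_lt_trans (dT _ _ _ Ax Ay Az) _.
    by rewrite -ltrBrDl.
  exists V; split=> // [y Ay Vy|_].
    by have : (V `&` A) y by []; rewrite -VE => -[].
  suff [] : (V `&` A) x by [].
  by rewrite -VE; split=> //; rewrite (dE _ _ Ax Ax).2 // invr_gt0.
have [V VP] := choice exV.
have exs n : exists s : seq X, forall x, M x -> exists2 c, c \in s & V (n, c) x.
  apply: (@compact_seq_cover _ M (fun c => V (n, c))) => // x Mx; exists x.
  by have [oV _ Vx] := VP (n, x); apply: open_nbhs_nbhs; split=> //; exact/Vx/MA.
have [s sP] := choice exs.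
(* [i] codes a pair: the level [n] and a position in the list of centers [s n]. Invalid codes give
   the empty set. *)
pose B i := if unpickle i is Some (n, k) then
  if onth (s n) k is Some c then V (n, c) else set0 else set0.
exists B; split=> [i|p U Mp].
  rewrite /B; case: unpickle => [[n k]|]; last exact: open0.
  by case: onth => [c|]; [have [] := VP (n, c)|exact: open0].
rewrite nbhsE => -[N [oN Np] NU].
have [|ballN _] := dO (N `&` A); first by move=> y [].
have {ballN} [||e [e0 ballN]] := ballN _ p.
- by exists N.
- by split=> //; exact: MA.
(* Two points in the same set of level [n] are both within 1/(n+1) of its center, hence less than
   [e] apart. *)
have [n ne] : exists n : nat, n.+1%:R^-1 < e / 2.
  have e20 : 0 < e / 2 by rewrite divr_gt0.
  by have [n _ /(_ n (leqnn n))] := near_infty_natSinv_lt (PosNum e20); exists n.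
have [c cs Vp] := sP n p Mp; have [_ VA _] := VP (n, c).
have /onthP[k sk] := cs.
exists (pickle (n, k)); rewrite /B pickleK sk.
split=> // y [Vy My]; have [/= Ac dcp] := VA p (MA _ Mp) Vp.
have [/= _ dcy] := VA y (MA _ My) Vy.
apply/NU; suff [] : (N `&` A) y by [].
apply: ballN; split; first exact: MA.
apply: le_lt_trans (dT _ _ _ (MA _ Mp) Ac (MA _ My)) _.
rewrite (dC _ _ (MA _ Mp) Ac) [e]splitr.
by apply: ltrD; [exact: lt_trans dcp ne|exact: lt_trans dcy ne].
Qed.
End Topology.

(** * Subspaces, and sequences extracted from noncompact sets *)

Lemma open_set_typeP (T : topologicalType) (H P : set T) :
  open [set x : set_type H | P (set_val x)] <->
  forall x, H x -> P x -> exists2 W, nbhs x W & W `&` H `<=` P.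
Proof.
split=> [[V oV VP] x Hx Px|HP].
  exists V.
    apply: open_nbhs_nbhs; split=> //.
    have : (set_val @^-1` V) (exist _ x (mem_set Hx)) by rewrite VP.
    by [].
  move=> y [Vy Hy].
  have : (set_val @^-1` V) (exist _ y (mem_set Hy)) by [].
  by rewrite VP.
exists (\bigcup_(W in [set W | open W /\ W `&` H `<=` P]) W).
  by apply: bigcup_open => W [].
apply/seteqP; split=> [[x Hx] /= [W [_ WP] Wx]|[x Hx] Px].
  by apply: WP; split=> //; exact: set_mem.
have [W] := HP x (set_mem Hx) Px.
rewrite nbhsE => -[V [oV Vx] VW] WP; exists V => //.
by split=> // y [/VW Wy Hy]; exact: WP.
Qed.

Lemma compact_set_type (T : topologicalType) (H A : set T) :
  compact A -> A `<=` H -> compact [set x : set_type H | A (set_val x)].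
Proof.
move=> cA AH F PF FA.
have [p [Ap clp]] := cA (set_val @ F) _ FA.
exists (exist _ p (mem_set (AH _ Ap))); split=> // B C FB.
rewrite nbhsE => -[_ [[V oV <-] Vp] VC].
have [|_ [[y By <-] Vy]] := clp (set_val @` B) V _ (open_nbhs_nbhs (conj oV Vp)).
  by apply: (@filterS _ F _ B) => // y By; exists y.
by exists y; split=> //; exact: VC.
Qed.

Lemma filter_forall_lt (T : Type) (F : set_system T) (P : nat -> set T) n :
  Filter F -> (forall i, (i < n)%N -> F (P i)) ->
  F [set y | forall i, (i < n)%N -> P i y].
Proof.
move=> FF; elim: n => [|n IH] FP; first by apply: filterS filterT => y _ [].
have FPn := FP n (ltnSn n).
have {}IH := IH (fun i ilt => FP i (ltnW ilt)).
apply: filterS (filterI IH FPn) => y [yP yn] i.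
by rewrite ltnS leq_eqVlt => /orP[/eqP -> //|]; exact: yP.
Qed.

Definition no_cluster_point_in (T : topologicalType) (H : set T) (x : nat -> T) :=
  forall z, H z -> exists2 W, nbhs z W & exists k0, forall k, (k0 <= k)%N -> ~ W (x k).

(** Let [F] be a filter on [Q] and [H] without cluster point there. Each [z] in both sets lies in
    some [S i] whose complement belongs to [F]. Choosing [x k] outside all such [S i] with [i < k]
    makes the sequence leave each of them for good; points outside [Q] are separated from it by
    closedness. *)
Lemma noncompact_sequence (T : topologicalType) (H Q : set T) (S : nat -> set T) :
  (forall i, open (S i)) ->
  (forall x W, H x -> nbhs x W -> exists i, S i x /\ S i `&` H `<=` W) ->
  closed Q -> ~ compact (Q `&` H) ->
  exists x : nat -> T, (forall k, Q (x k) /\ H (x k)) /\ no_cluster_point_in H x.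
Proof.
move=> oS SH clQ /existsNP[F /not_implyP[PF /not_implyP[FQH Fcl]]].
have FS z : (Q `&` H) z -> exists i, S i z /\ F (~` S i).
  move=> QHz; have /existsNP[B /existsNP[C]] : ~ cluster F z.
    by move=> clz; apply: Fcl; exists z.
  move=> /not_implyP[FB /not_implyP[nC /set0P/negP/negPn/eqP BC]].
  have [i [Siz SC]] := SH z C QHz.2 nC; exists i; split=> //.
  apply: filterS (filterI FB FQH) => y [By [_ Hy]] Siy.
  suff : set0 y by [].
  by rewrite -BC; split=> //; exact: SC.
pose N k := Q `&` H `&` [set y | forall i, (i < k)%N -> F (~` S i) -> ~ S i y].
have FN k : F (N k).
  apply: filterI => //; apply: filter_forall_lt => i _.
  have [FSi|nFSi] := pselect (F (~` S i)).
    by apply: filterS FSi.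
  by apply: filterS FQH.
have [x xN] := choice (fun k => filter_ex (FN k)).
exists x; split=> [k|z Hz]; first by have [] := xN k.
have [Qz|nQz] := pselect (Q z).
  have [i [Siz FSi]] := FS z (conj Qz Hz).
  exists (S i); first exact: open_nbhs_nbhs.
  by exists i.+1 => k ik; have [_] := xN k; apply.
exists (~` Q); first by apply: open_nbhs_nbhs; split=> //; exact: closed_openC.
by exists 0%N => k _; apply; have [[]] := xN k.
Qed.

(** * Evaluation and composition in the compact-open topology *)

Section CompactOpen.
Context {X : topologicalType}.
Notation CO := (@compact_open X X).

Lemma nbhs_eval (f : CO) (x : X) (U : set X) :
  open U -> U (f x) -> nbhs f [set g : CO | U (g x)].
Proof.
move=> oU Ufx.
have : nbhs f ([set g | g @` [set x] `<=` U] : set CO).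
  apply: open_nbhs_nbhs; split; last by move=> _ [_ -> <-].
  by apply: compact_open_open => //; exact: compact_set1.
by apply: filterS => g gU; apply: gU; exists x.
Qed.

Lemma comp_left_continuous (h : X -> X) :
  continuous h -> continuous (fun g : CO => (h \o g : CO)).
Proof.
move=> ch g.
have FF : Filter ((fun g : CO => (h \o g : CO)) @ nbhs g) by apply: fmap_filter.
apply/compact_open_cvgP => K U cK oU gKU.
have : nbhs g ([set v | v @` K `<=` h @^-1` U] : set CO).
  apply: open_nbhs_nbhs; split.
    by apply: compact_open_open => //; move/continuousP : ch; exact.
  by move=> _ [x Kx <-]; apply: gKU; exists x.
apply: (@filterS _ _ (@nbhs_filter CO g)) => v vK _ [x Kx <-].
by apply: vK; exists x.
Qed.

Lemma comp_nbhs (f g : CO) (W : set CO) :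
  locally_compact [set: X] -> hausdorff_space X ->
  continuous (f : X -> X) -> continuous (g : X -> X) ->
  nbhs (f \o g : CO) W ->
  exists N N' : set CO, [/\ nbhs f N, nbhs g N' &
    forall u v : X -> X, N u -> N' v -> W (u \o v)].
Proof.
move=> lcX hX cf cg nW.
have : (fun p : CO * CO => (p.1 \o p.2 : CO)) @ (nbhs f, nbhs g) --> (f \o g : CO).
  apply/compact_open_cvgP => K U cK oU fgKU.
  have [|||L [oL gKL LfU cL]] := @compact_nbhd X (g @` K) (f @^-1` U) lcX hX.
  - by apply: continuous_compact => //; exact: continuous_subspaceT.
  - by move/continuousP : cf; exact.
  - by move=> _ [x Kx <-]; apply: fgKU; exists x.
  exists ([set u | u @` closure L `<=` U], [set v | v @` K `<=` L]).
    split; apply: open_nbhs_nbhs; split => //; try exact: compact_open_open.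
    by move=> _ [x /LfU Ux <-].
  move=> [u v] /= [uL vK] _ [x Kx <-]; apply: uL; exists (v x) => //.
  by apply: subset_closure; apply: vK; exists x.
move=> /(_ W nW) [[N N'] [nN nN'] NW]; exists N, N'; split=> // u v Nu N'v.
exact: (NW (u, v)).
Qed.

End CompactOpen.

(** * The groups Homeo_K(X): group laws, countable bases, translations *)

Section HomeoK.
Context {X : topologicalType}.
Notation CO := (@compact_open X X).
Implicit Types (K L M : set X) (f g h : X -> X).

Lemma homeo_continuous f : homeo f -> continuous f.
Proof. by case=> g []. Qed.

Lemma HomeoK_id K : HomeoK K id.
Proof. by split=> //; exists id; split=> // x; exact: cvg_id. Qed.

Lemma HomeoK_comp K f g : HomeoK K f -> HomeoK K g -> HomeoK K (f \o g).
Proof.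
move=> [[f' [fK f'K cf cf']] fid] [[g' [gK g'K cg cg']] gid]; split.
  exists (g' \o f'); split; [exact: can_comp|exact: can_comp| |].
    by move=> x; apply: continuous_comp; [exact: cg|exact: cf].
  by move=> x; apply: continuous_comp; [exact: cf'|exact: cg'].
by move=> x Kx; rewrite /= gid ?fid.
Qed.

Lemma HomeoK_inv K f : HomeoK K f ->
  exists g, [/\ HomeoK K g, cancel f g & cancel g f].
Proof.
move=> [[g [fK gK cf cg]] fid]; exists g; split=> //; split; first by exists f.
by move=> x Kx; rewrite -[in LHS](fid x Kx) fK.
Qed.

Lemma HomeoK_mono K L : K `<=` L -> HomeoK K `<=` HomeoK L.
Proof. by move=> KL f [hf fid]; split=> // x Lx; apply: fid => /KL. Qed.

Lemma HomeoK_setI K L f : HomeoK K f -> HomeoK L f -> HomeoK (K `&` L) f.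
Proof.
move=> [hf fK] [_ fL]; split=> // x /not_andP[]; [exact: fK|exact: fL].
Qed.

Lemma HomeoK_stable K f x : HomeoK K f -> K x -> K (f x).
Proof.
move=> [[g [fK _ _ _]] fid] Kx; apply: contrapT => nKfx.
(* A value [f x] outside [K] is fixed by [f], so injectivity gives [f x = x]. *)
by apply: (nKfx); rewrite (can_inj fK (fid _ nKfx)).
Qed.

(** Some [x] outside [K] is moved by [f], and then by all maps close to [f]. *)
Lemma nbhs_notin_HomeoK K (f : CO) : hausdorff_space X -> homeo f ->
  ~ HomeoK K f -> nbhs f (~` HomeoK K).
Proof.
move=> hX hf nKf.
have [x [nKx fx]] : exists x, ~ K x /\ f x <> x.
  apply: contrapT => nex; apply: nKf; split=> // x nKx.
  by apply: contrapT => fx; apply: nex; exists x.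
have clx : closed [set x] by apply: compact_closed => //; exact: compact_set1.
have := nbhs_eval (closed_openC clx) fx.
by apply: filterS => g gx [_ /(_ x nKx)].
Qed.

(* With [BU s] the finite unions of basic open sets of M and [C s] their closures
   in M, the sets [{g | g (C s) <= BU t}] form a subbase of Homeo_M(X), and
   [{g | g (C s) <= C t}] are closed neighborhoods. *)
Lemma HomeoK_countable_base (A M : set X) :
  locally_compact [set: X] -> hausdorff_space X ->
  metrizable_set A -> compact M -> M `<=` A ->
  exists S Q : nat -> set CO,
    [/\ forall i, open (S i), forall i, closed (Q i),
        forall i, S i `&` HomeoK M `<=` Q i &
        forall (f : CO) W, HomeoK M f -> nbhs f W ->
          exists i, S i f /\ Q i `&` HomeoK M `<=` W].
Proof.
move=> lcX hX mA cM MA; have [B [oB Bbase]] := metrizable_compact_base mA cM MA.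
have clM : closed M by exact: compact_closed.
pose BU (s : seq nat) := [set x | exists2 i, i \in s & B i x].
pose C s := closure (BU s `&` M).
have oBU s : open (BU s).
  rewrite (_ : BU s = \bigcup_(i in [set i | i \in s]) B i).
    exact: bigcup_open.
  by apply/seteqP; split=> x [i]; exists i.
have CM s : C s `<=` M.
  by rewrite [X in _ `<=` X](closure_id M).1 //; apply: closureS => x [].
have cC s : compact (C s).
  by apply: subclosed_compact (CM s) => //; exact: closed_closure.
have sep K U : compact K -> K `<=` M -> open U -> K `<=` U ->
    exists s, K `<=` BU s /\ C s `<=` U.
  move=> cK KM oU KU; have [N [oN KN NU _]] := compact_nbhd lcX hX cK oU KU.
  have [|s sK] := @compact_seq_cover _ _ K
      (fun i => [set x | B i x /\ B i `&` M `<=` N]) cK.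
    move=> x Kx.
    have [|i [Bix BiN]] := Bbase x N (KM _ Kx).
      by apply: open_nbhs_nbhs; split=> //; exact: KN.
    exists i; have : nbhs x (B i) by exact: open_nbhs_nbhs.
    by apply: filterS.
  exists [seq i <- s | `[< B i `&` M `<=` N >]]; split.
    move=> x /sK[i si [Bix BiN]]; exists i => //.
    by rewrite mem_filter si andbT; exact/asboolP.
  apply: subset_trans NU; apply: closureS => x [[i]].
  by rewrite mem_filter => /andP[/asboolP BiN _] Bix Mx; exact: BiN.
pose S (l : seq (seq nat * seq nat)) : set CO :=
  [set g | forall p, p \in l -> g @` C p.1 `<=` BU p.2].
pose Q (l : seq (seq nat * seq nat)) : set CO :=
  [set g | forall p, p \in l -> g @` C p.1 `<=` C p.2].
have oS l : open (S l).
  elim: l => [|p l IH].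
    by rewrite (_ : S [::] = setT); [exact: openT|apply/seteqP; split].
  rewrite (_ : S (p :: l) = ([set g | g @` C p.1 `<=` BU p.2] : set CO) `&` S l).
    by apply: openI => //; exact: compact_open_open.
  apply/seteqP; split=> g => [Sg|[gp Sg] q].
    split; first by apply: Sg; rewrite mem_head.
    by move=> q ql; apply: Sg; rewrite inE ql orbT.
  by rewrite inE => /orP[/eqP -> //|]; exact: Sg.
have clQ l : closed (Q l).
  rewrite -[Q l]setCK; apply: open_closedC; rewrite openE => g nQg.
  have [p [pl [y [Cy nCy]]]] :
      exists p, p \in l /\ exists y, C p.1 y /\ ~ C p.2 (g y).
    apply: contrapT => nex; apply: nQg => p pl _ [y Cy <-].
    by apply: contrapT => nCy; apply: nex; exists p; split=> //; exists y.
  have := nbhs_eval (closed_openC (@closed_closure _ (BU p.2 `&` M))) nCy.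
  apply: (@filterS _ _ (@nbhs_filter CO g)) => h hy Qh; apply: hy.
  by apply: (Qh p pl); exists y.
have SQ l : S l `&` HomeoK M `<=` Q l.
  move=> g [Sg Mg] p pl _ [y Cy <-]; apply: subset_closure; split.
    by apply: (Sg p pl); exists y.
  by apply: (HomeoK_stable Mg); exact: CM Cy.
pose F (f : CO) := filter_from [set l | S l f] (fun l => Q l `&` HomeoK M).
have FF f : Filter (F f).
  apply: filter_from_filter; first by exists [::].
  move=> l l' Slf Sl'f; exists (l ++ l').
    by move=> p; rewrite mem_cat => /orP[]; [exact: Slf|exact: Sl'f].
  move=> g [Qg Mg]; split; split=> // p pl; apply: Qg;
    by rewrite mem_cat pl ?orbT.
have Ff (f : CO) : HomeoK M f -> F f --> f.
  move=> Mf; apply/compact_open_cvgP => K U cK oU fKU.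
  have cf : continuous (f : X -> X) by apply: homeo_continuous; case: Mf.
  (* Two separations: [C s] fits between the part of [K] in [M] and the preimage of [U], then [C t]
     between the image of [C s] and [U]. On the rest of [K], both [f] and [g] are the identity. *)
  have [|||s [Ks sU]] := sep (K `&` M) (f @^-1` U) (compact_closedI cK clM).
  - by move=> x [].
  - by move/continuousP : cf; exact.
  - by move=> x [Kx _]; apply: fKU; exists x.
  have [||||t [st tU]] := sep (f @` C s) U.
  - by apply: continuous_compact => //; exact: continuous_subspaceT.
  - by move=> _ [x /CM Mx <-]; exact: HomeoK_stable Mf Mx.
  - by [].
  - by move=> _ [x /sU Ux <-].
  exists [:: (s, t)]; first by move=> p; rewrite inE => /eqP ->.
  move=> g [Qg Mg] _ [x Kx <-]; have [Mx|nMx] := pselect (M x).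
    apply: tU; apply: (Qg (s, t)); first by rewrite mem_head.
    by exists x => //; apply: subset_closure; split=> //; exact: Ks.
  by rewrite (Mg.2 x nMx) -(Mf.2 x nMx); apply: fKU; exists x.
pose idx (i : nat) : seq (seq nat * seq nat) := odflt [::] (unpickle i).
exists (S \o idx), (Q \o idx); split=> [i|i|i|f W Mf nW].
- exact: oS.
- exact: clQ.
- exact: SQ.
have [l Slf QW] := Ff f Mf W nW.
by exists (pickle l); rewrite /= /idx pickleK.
Qed.

(** Left composition with [f] carries the compact neighborhood of the identity cut out by [Q] to one
    of [f], cut out by the closed set [P]. *)
Lemma HomeoK_locally_compact M (Q : set CO) : hausdorff_space X ->
  closed Q -> (exists2 W, nbhs (id : CO) W & W `&` HomeoK M `<=` Q) ->
  compact (Q `&` HomeoK M) -> locally_compact [set: set_type (HomeoK M)].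
Proof.
move=> hX clQ [W nW WQ] cQ [f Hf] _.
have Mf := set_mem Hf; have [g [Mg fK gK]] := HomeoK_inv Mf.
have cf : continuous f by apply: homeo_continuous; case: Mf.
have cg : continuous g by apply: homeo_continuous; case: Mg.
have Lg := comp_left_continuous cg; have Lf := comp_left_continuous cf.
pose P : set CO := [set u | Q (g \o u)].
have nP : nbhs (f : CO) [set u : CO | W (g \o u)].
  have := Lg f; rewrite /continuous_at /=.
  have -> : (g \o f : CO) = id by apply/funext => x; exact: fK.
  by apply.
have clP : closed P by move/continuous_closedP : Lg => /(_ Q clQ).
exists [set u : set_type (HomeoK M) | P (set_val u)].
  move: nP; rewrite nbhsE => -[V [oV Vf] VP].
  exists (set_val @^-1` V); first by split=> //; exists V.
  move=> u Vu _; apply: WQ; split; first exact: VP.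
  by apply: HomeoK_comp => //; exact: (set_mem (valP u)).
split.
  rewrite (_ : [set u | _] = [set u : set_type (HomeoK M) |
      ((fun u => f \o u) @` (Q `&` HomeoK M)) (set_val u)]).
    apply: compact_set_type.
      apply: (@continuous_compact CO CO) => //.
      exact: continuous_subspaceT.
    by move=> _ [u [_ Mu] <-]; exact: HomeoK_comp.
  apply/seteqP; split=> [[u Hu] Pu|[u Hu] /= [v [Qv _]]].
    exists (g \o u).
      by split=> //; apply: HomeoK_comp => //; exact: set_mem.
    by apply/funext => x; exact: gK.
  rewrite set_valE /= => <-; rewrite /P /=.
  by have -> : g \o (f \o v) = v by apply/funext => x; exact: fK.
have /continuous_closedP := @initial_continuous (set_type (HomeoK M)) CO set_val.
by move=> /(_ P clP).
Qed.

(** Openness of the subgroup tested at the identity only; translations spread it to the other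
    elements. For [K = set0] it says that the identity is isolated in Homeo_L(X). *)
Definition relatively_open K L :=
  exists2 W : set CO, nbhs (id : CO) W & W `&` HomeoK L `<=` HomeoK K.

Lemma relatively_open_open K L : K `<=` L -> relatively_open K L ->
  open [set f : set_type (HomeoK L) | HomeoK K (set_val f)].
Proof.
move=> KL [W nW WK]; apply/(@open_set_typeP CO) => f Lf Kf.
have [g [Kg fK gK]] := HomeoK_inv Kf.
have cg : continuous g by apply: homeo_continuous; case: Kg.
exists [set u : CO | W (g \o u)].
  have := comp_left_continuous cg (x := f); rewrite /continuous_at /=.
  have -> : (g \o f : CO) = id by apply/funext => x; exact: fK.
  by apply.
move=> u [Wu Lu].
have -> : u = f \o (g \o u) by apply/funext => x; rewrite /= gK.
apply: HomeoK_comp => //; apply: WK; split=> //.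
by apply: HomeoK_comp => //; exact: HomeoK_mono Kg.
Qed.

Lemma HomeoK_discrete K : relatively_open set0 K ->
  discrete_top (set_type (HomeoK K)).
Proof.
move=> [W nW W0] [f Hf].
have Kf := set_mem Hf; have [g [Kg fK gK]] := HomeoK_inv Kf.
have cg : continuous g by apply: homeo_continuous; case: Kg.
rewrite (_ : [set _] = [set u : set_type (HomeoK K) | set_val u = f]); last first.
  by apply/seteqP; split=> [_ -> //|u /= uf]; exact: val_inj.
apply/(@open_set_typeP CO _ [set f]) => _ _ ->.
exists [set u : CO | W (g \o u)].
  have := comp_left_continuous cg (x := f); rewrite /continuous_at /=.
  have -> : (g \o f : CO) = id by apply/funext => x; exact: fK.
  by apply.
move=> u [Wu Ku].
have [_ gu] : HomeoK set0 (g \o u) by apply: W0; split=> //; exact: HomeoK_comp.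
by apply/funext => x; rewrite -[LHS]gK [g _]gu.
Qed.

(** The [n]-th set intersects those [Q i], [i < n], for which [S i] contains the identity. These
    sets decrease, so being inside [W] persists from [i.+1] on. *)
Lemma HomeoK_countable_base_id (A M : set X) :
  locally_compact [set: X] -> hausdorff_space X ->
  metrizable_set A -> compact M -> M `<=` A ->
  exists N : nat -> set CO,
    [/\ forall n, closed (N n),
        forall n, exists2 W, nbhs (id : CO) W & W `&` HomeoK M `<=` N n &
        forall W, nbhs (id : CO) W ->
          exists n0, forall n, (n0 <= n)%N -> N n `&` HomeoK M `<=` W].
Proof.
move=> lcX hX mA cM MA.
have [S [Q [oS clQ SQ base]]] := HomeoK_countable_base lcX hX mA cM MA.
exists (fun n => \bigcap_(i in [set i | (i < n)%N /\ S i id]) Q i); split=> [n|n|W nW].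
- exact: closed_bigI.
- exists [set g | forall i, (i < n)%N -> S i id -> S i g].
    apply: (@filter_forall_lt _ _ (fun i => [set g | S i id -> S i g])) => i _.
    have [Si|nSi] := pselect (S i id).
      have : nbhs (id : CO) (S i) by exact: open_nbhs_nbhs.
      by apply: filterS => g Sg _.
    have : nbhs (id : CO) setT by exact: filterT.
    by apply: filterS => g _ /nSi.
  by move=> g [Sg Mg] i [ilt Si]; apply: SQ; split=> //; exact: Sg.
have [i [Si QW]] := base id W (HomeoK_id M) nW.
exists i.+1 => n ilt g [Ng Mg]; apply: QW; split=> //.
by apply: Ng; split.
Qed.

(** * Sequences of homeomorphisms: convergence to the identity and cluster points *)

Definition converges_to_id (h : nat -> CO) :=
  forall W, nbhs (id : CO) W -> exists k0, forall k, (k0 <= k)%N -> W (h k).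

Lemma not_relatively_open_sequence (A K L : set X) :
  locally_compact [set: X] -> hausdorff_space X ->
  metrizable_set A -> compact L -> L `<=` A -> ~ relatively_open K L ->
  exists h : nat -> CO,
    (forall k, HomeoK L (h k) /\ ~ HomeoK K (h k)) /\ converges_to_id h.
Proof.
move=> lcX hX mA cL LA nKL.
have [N [_ nN Nbase]] := HomeoK_countable_base_id lcX hX mA cL LA.
have exh k : exists h : CO, N k h /\ (HomeoK L h /\ ~ HomeoK K h).
  have [W nW WN] := nN k; apply: contrapT => nex; apply: nKL; exists W => //.
  move=> h [Wh Lh]; apply: contrapT => nKh; apply: nex; exists h.
  by split=> //; exact: WN.
have [h hP] := choice exh; exists h; split=> [k|W nW]; first by have [] := hP k.
have [k0 k0P] := Nbase W nW; exists k0 => k kk0.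
by have [Nh [Lh _]] := hP k; apply: (k0P k).
Qed.

(** No closed basic neighborhood [N n] has compact trace on Homeo_M(X), so each trace contains a
    sequence without cluster point. As the whole [n]-th sequence lies in [N n], convergence to the
    identity in [n] is uniform in [k]. *)
Lemma not_locally_compact_sequences M :
  locally_compact [set: X] -> hausdorff_space X ->
  compact M -> metrizable_set M ->
  ~ locally_compact [set: set_type (HomeoK M)] ->
  exists x : nat -> nat -> CO,
    [/\ forall n k, HomeoK M (x n k),
        forall n, no_cluster_point_in [set f : CO | homeo f] (x n) &
        forall W, nbhs (id : CO) W ->
          exists n0, forall n k, (n0 <= n)%N -> W (x n k)].
Proof.
move=> lcX hX cM mM nlc.
have MM : M `<=` M by [].
have [N [clN nN Nbase]] := HomeoK_countable_base_id lcX hX mM cM MM.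
have [S [Q [oS _ SQ base]]] := HomeoK_countable_base lcX hX mM cM MM.
have exx n : exists x : nat -> CO, (forall k, N n (x k) /\ HomeoK M (x k)) /\
    no_cluster_point_in (HomeoK M) x.
  apply: (noncompact_sequence oS) => //.
    move=> f W Mf nW; have [i [Sf QW]] := base f W Mf nW.
    exists i; split=> // g [Sg Mg]; apply: QW; split=> //; exact: SQ.
  move=> cNM; apply: nlc.
  exact: (HomeoK_locally_compact hX (clN n) (nN n) cNM).
have [x xP] := choice exx; exists x; split=> [n k|n f hf|W nW].
- by have [/(_ k) []] := xP n.
- have [xM xcl] := xP n; have [Mf|nMf] := pselect (HomeoK M f).
    exact: xcl.
  exists (~` HomeoK M); first by apply: nbhs_notin_HomeoK.
  by exists 0%N => k _; apply; have [] := xM k.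
have [n0 n0P] := Nbase W nW; exists n0 => n k nn0.
by have [/(_ k) Nx _] := xP n; apply: (n0P n).
Qed.

(** By joint continuity of composition at (f, id), a cluster point [f] of [y] would also be one of
    [x]. *)
Lemma no_cluster_point_in_comp (x y h : nat -> CO) :
  locally_compact [set: X] -> hausdorff_space X ->
  (forall k, x k = y k \o h k) -> converges_to_id h ->
  no_cluster_point_in [set f : CO | homeo f] x ->
  no_cluster_point_in [set f : CO | homeo f] y.
Proof.
move=> lcX hX xyh hid xcl f hf; have [W nW [k0 k0P]] := xcl f hf.
have [|N [N' [nN nN' NW]]] :=
  @comp_nbhs _ f id W lcX hX (homeo_continuous hf) _ nW.
  by move=> t; exact: cvg_id.
have [k1 k1P] := hid N' nN'.
exists N => //; exists (maxn k0 k1) => k; rewrite geq_max => /andP[kk0 kk1] Ny.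
by apply: (k0P k kk0); rewrite xyh; apply: NW => //; exact: k1P.
Qed.

(** A tail of the sequence stays out of a neighborhood of [f]; each of the finitely many earlier
    terms differs from [f] at some point, and evaluation there separates them. *)
Lemma nbhs_avoid_sequence (y : nat -> CO) (f : CO) : hausdorff_space X ->
  homeo f -> no_cluster_point_in [set f : CO | homeo f] y ->
  (forall k, y k <> f) -> nbhs f [set g | forall k, y k <> g].
Proof.
move=> hX hf ycl yf; have [W nW [k0 k0P]] := ycl f hf.
have nk : nbhs f [set g | forall k, (k < k0)%N -> y k <> g].
  apply: (@filter_forall_lt _ _ (fun k => [set g | y k <> g])) => k _.
  have [t yft] : exists t, f t <> y k t.
    apply: contrapT => nex; apply: (yf k); apply/funext => t.
    by apply: contrapT => yt; apply: nex; exists t => /esym.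
  have clt : closed [set y k t] by apply: compact_closed => //; exact: compact_set1.
  have := nbhs_eval (closed_openC clt) yft.
  by apply: filterS => g gt yg; apply: gt; rewrite yg.
apply: filterS (filterI nW nk) => g [Wg gk] k yg.
have [kk0|k0k] := ltnP k k0; first exact: (gk k).
by apply: (k0P k k0k); rewrite yg.
Qed.

End HomeoK.

(** * Regular closed exhaustions, and homeomorphisms supported in a frontier *)

Section Exhaustion.
Context {X : topologicalType}.
Implicit Types A C K : set X.

Lemma regular_closed_closure (U : set X) : open U -> regular_closed (closure U).
Proof.
move=> oU; apply/seteqP; split.
  by apply: closureS; rewrite -open_subsetE //; exact: subset_closure.
rewrite [X in _ `<=` X](closure_id (closure U)).1; last exact: closed_closure.
by apply: closureS; exact: interior_subset.
Qed.

Lemma regular_closed_closed A : regular_closed A -> closed A.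
Proof. by move=> ->; exact: closed_closure. Qed.

(** With [U n] the union of the first [n] relatively compact open sets around the pieces of [A],
    take the closures of the traces of [U n] on the interior of [A]. A compact [C] in [A] lies in
    some [U n], and the interior is dense in [A], so [C] lies in that closure. *)
Lemma regular_closed_exhaustion A :
  locally_compact [set: X] -> hausdorff_space X ->
  regular_closed A -> sigma_compact A ->
  exists K : nat -> set X,
    [/\ forall n, regular_closed (K n) /\ compact (K n), forall n, K n `<=` A,
        forall m n, (m <= n)%N -> K m `<=` K n &
        forall C, compact C -> C `<=` A -> exists n, C `<=` K n].
Proof.
move=> lcX hX rA [D [cD AD]].
have exO n : exists O : set X, [/\ open O, D n `<=` O & compact (closure O)].
  have [||O [oO DO _ cO]] := @compact_nbhd X (D n) setT lcX hX (cD n).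
  - exact: openT.
  - by [].
  - by exists O.
have [N_ OP] := choice exO.
pose U n := \bigcup_(i in [set i | (i < n)%N]) N_ i.
have oU n : open (U n) by apply: bigcup_open => i _; case: (OP i).
have UA n : closure (U n `&` A°) `<=` A.
  rewrite {2}rA; apply: closureS; exact: subIsetr.
have UC n : closure (U n) `<=` \big[setU/set0]_(i <- iota 0 n) closure (N_ i).
  have clB : closed (\big[setU/set0]_(i <- iota 0 n) closure (N_ i)).
    by apply: closed_bigsetU => i _; exact: closed_closure.
  rewrite [X in _ `<=` X](closure_id _).1 //; apply: closureS => x [i ilt Ox].
  rewrite -bigcup_seq; exists i; last exact: subset_closure.
  by rewrite /= mem_iota.
exists (fun n => closure (U n `&` A°)); split=> [n|n|m n mn|C cC CA].
- split.
    by apply: regular_closed_closure; apply: openI => //; exact: open_interior.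
  apply: (@subclosed_compact _ _ (\big[setU/set0]_(i <- iota 0 n) closure (N_ i))).
  + exact: closed_closure.
  + by apply: bigsetU_compact => i _; case: (OP i).
  + by apply: subset_trans (UC n); apply: closureS; exact: subIsetl.
- exact: UA.
- apply: closureS; apply: setSI => x [i im Ox]; exists i => //=.
  exact: leq_trans im mn.
have [|s sC] := compact_seq_cover (P := N_) cC.
  move=> x /CA; rewrite AD => -[i _ Dx]; exists i; have [oO DO _] := OP i.
  by apply: open_nbhs_nbhs; split=> //; exact: DO.
(* The successor is needed because [U n] only collects indices below [n]. *)
exists (\max_(i <- s) i).+1 => x Cx.
have [i si Oix] := sC x Cx.
have nU : nbhs x (U (\max_(i <- s) i).+1).
  apply: open_nbhs_nbhs; split=> //; exists i => //=.
  by rewrite ltnS; apply: leq_bigmax_seq.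
have Ax : closure (A°) x by rewrite -rA; exact: CA.
move=> V nV; have [z [Az [Uz Vz]]] := Ax _ (filterI nU nV).
by exists z.
Qed.

(** Near the identity, [f] fixes the complement of [K0]. It also fixes the interior of [K0], which
    [C] misses. That interior is dense in [K0] and X is Hausdorff, so [f] is the identity. *)
Lemma relatively_open_frontier A C K0 : hausdorff_space X ->
  regular_closed K0 -> C `<=` closure (A `\` K0) ->
  relatively_open K0 C -> relatively_open set0 C.
Proof.
move=> hX rK0 CA [W nW WK0]; exists W => // f [Wf Cf].
have Kf : HomeoK K0 f by exact: WK0.
split=> [|x _]; first by case: Cf.
have cf : continuous f by apply: homeo_continuous; case: Cf.
have fint y : K0° y -> f y = y.
  move=> Ky; apply: (Cf.2) => /CA /(_ _ (nbhs_interior Ky)) [z [[_ nKz] Kz]].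
  by apply: nKz; exact: interior_subset.
have [Kx|] := pselect (K0 x); last exact: (Kf.2).
apply: contrapT => /eqP; move: (hX); rewrite open_hausdorff => /[apply].
case=> -[V V'] /= [/set_mem Vfx /set_mem V'x] [oV oV' /eqP VV'].
have clx : closure (K0°) x by rewrite -rK0.
have nx : nbhs x (V' `&` f @^-1` V).
  apply: filterI; first exact: open_nbhs_nbhs.
  by apply: cf; exact: open_nbhs_nbhs.
have [y [/fint fy [V'y]]] := clx _ nx; rewrite /= fy => Vy.
suff : set0 y by [].
by rewrite -VV'.
Qed.

End Exhaustion.

(** * The contradiction with ACP *)

Lemma ACP_relatively_open (X : topologicalType) (A M : set X) (K : nat -> set X) :
  locally_compact [set: X] -> hausdorff_space X ->
  closed A -> metrizable_set A ->
  (forall n, compact (K n)) -> (forall n, K n `<=` A) ->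
  (forall m n, (m <= n)%N -> K m `<=` K n) ->
  (forall C, compact C -> C `<=` A -> exists n, C `<=` K n) ->
  ACP_Homeo (X := X) ->
  compact M -> metrizable_set M ->
  ~ locally_compact [set: set_type (HomeoK M)] ->
  exists n, forall m, (n <= m)%N -> relatively_open (K n) (K m).
Proof.
move=> lcX hX clA mA cK KA Kmono Kexh [ACPmul ACPinv] cM mM nlc.
pose CO := @compact_open X X.
apply: contrapT => nopen.
have exm n : exists m, (n <= m)%N /\ ~ relatively_open (K n) (K m).
  apply: contrapT => nex; apply: nopen; exists n => m nm.
  by apply: contrapT => nrel; apply: nex; exists m.
have [m mP] := choice exm.
have [x [xM xcl xid]] := not_locally_compact_sequences lcX hX cM mM nlc.
have [h hP] := choice (fun n => not_relatively_open_sequence lcX hX mA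
  (cK (m n)) (@KA (m n)) (mP n).2).
have exh' (nk : nat * nat) : exists h' : CO, [/\ HomeoK (K (m nk.1)) h',
    cancel (h nk.1 nk.2) h' & cancel h' (h nk.1 nk.2)].
  by have [/(_ nk.2) [Kh _] _] := hP nk.1; exact: HomeoK_inv Kh.
have [h' h'P] := choice exh'.
pose y n k : CO := x n k \o h' (n, k).
have xyh n k : x n k = y n k \o h n k.
  by apply/funext => t; have [_ hK _] := h'P (n, k); rewrite /y /= hK.
have ycl n : no_cluster_point_in [set f : CO | homeo f] (y n).
  by apply: (no_cluster_point_in_comp lcX hX (xyh n)) => //; case: (hP n).
(* If [y n k] were supported in [C], then its inverse composed with [x n k], which is [h n k], would
   be supported in the union of [C] and [M], and in [K (m n)], hence in [K q] and in [K n], against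
   the choice of [h]. *)
have yC (C : set X) q n k : (C `|` M) `&` A `<=` K q -> (q <= n)%N ->
    ~ HomeoK C (y n k).
  move=> CK qn Cy; have [/(_ k) [Kh nKh] _] := hP n; apply: nKh.
  have Cy' : HomeoK (C `|` M) (y n k) by apply: HomeoK_mono Cy; exact: subsetUl.
  have Cx' : HomeoK (C `|` M) (x n k) by apply: HomeoK_mono (xM n k); exact: subsetUr.
  have [z [Cz yz _]] := HomeoK_inv Cy'.
  have Ch : HomeoK (C `|` M) (h n k).
    have -> : h n k = z \o x n k by apply/funext => t; rewrite xyh /= yz.
    exact: HomeoK_comp.
  apply: HomeoK_mono (HomeoK_setI Ch Kh) => t [Ct Kt].
  by apply: (Kmono q n qn); apply: CK; split=> //; exact: KA Kt.
have exq (C : set X) : compact C -> exists q, (C `|` M) `&` A `<=` K q.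
  move=> cC; apply: Kexh; last exact: subIsetr.
  by apply: compact_closedI => //; exact: compactU.
(* From level [p] on, [K n] contains the part of [M] in [A], so that no [y n k] is the identity. *)
have [p pM] := exq _ (@compact0 X).
pose W : set (X -> X) :=
  [set f | Homeo_c f /\ forall n k, (p <= n)%N -> y n k <> f].
have oW : colim_open W.
  split=> [f []//|C cC]; apply/(@open_set_typeP CO) => f Cf [_ yf].
  have [q qC] := exq C cC.
  (* In Homeo_C(X) only levels below [q] occur, so finitely many sequences have to be avoided. *)
  exists [set g | forall n, (n < q)%N -> (p <= n)%N -> forall k, y n k <> g].
    apply: (@filter_forall_lt _ _
      (fun n => [set g | (p <= n)%N -> forall k, y n k <> g])) => n _.
    have [pn|np] := leqP p n; last first.
      have : nbhs (f : CO) setT by exact: filterT.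
      by apply: filterS => g _.
    have := nbhs_avoid_sequence hX (Cf.1) (ycl n) (fun k => yf n k pn).
    by apply: filterS => g gy _.
  move=> g [gq Cg]; split; first by exists C.
  move=> n k pn yg; have [nq|qn] := ltnP n q; first exact: (gq n nq pn k).
  by apply: (yC C q n k qC qn); rewrite yg.
have idc : Homeo_c (id : X -> X).
  by exists set0; split; [exact: compact0|exact: HomeoK_id].
have Wid : W (id \o id).
  split=> // n k pn yid; apply: (yC set0 p n k pM pn).
  by rewrite yid; exact: HomeoK_id.
have [U [V [oU oV Uid Vid UVW]]] := ACPmul id id idc idc W oW Wid.
have [W1 nW1 W1U] := (open_set_typeP _ _).1 (oU.2 M cM) id (HomeoK_id M) Uid.
have [n0 n0P] := xid W1 nW1.
(* The order of choice matters: [U] determines the level [n], which fixes the group Homeo of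
   [K (m n)]; only then does [V] determine [k]. *)
pose n := maxn n0 p.
(* The second factor is the inverse of [h n k], so [h n k] itself must enter the set of inverses of
   [V]. *)
have oV' := ACPinv V oV.
have [|W2 nW2 W2V] :=
  (open_set_typeP _ _).1 (oV'.2 (K (m n)) (cK _)) id (HomeoK_id _).
  by split=> //; exists id.
have [hK /(_ W2 nW2) [k /(_ k (leqnn k)) W2h]] := hP n.
have [_ [v [Vv vh]]] : [set g | Homeo_c g /\
    exists h, V h /\ forall x, h (g x) = x] (h n k).
  by apply: W2V; split=> //; case: (hK k).
have vh' : v = h' (n, k).
  by apply/funext => t; have [_ _ h'K] := h'P (n, k); rewrite -[in LHS](h'K t) vh.
have [_ /(_ n k (leq_maxr _ _))] : W (y n k); last by [].
rewrite /y -vh'; apply: UVW => //; apply: W1U; split=> //.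
by apply: n0P; exact: leq_maxl.
Qed.

Theorem theorem4p1 (X : topologicalType) (A : set X) :
  locally_compact [set: X] -> hausdorff_space X ->
  regular_closed A -> sigma_compact A -> ~ compact A -> metrizable_set A ->
  ACP_Homeo (X := X) ->
  (forall M : set X, compact M -> metrizable_set M ->
     locally_compact [set: set_type (HomeoK M)])
  \/
  (exists K0 : set X,
     [/\ regular_closed K0, compact K0, K0 `<=` A,
         (forall K : set X, compact K -> K0 `<=` K -> K `<=` A ->
            open [set f : set_type (HomeoK K) | HomeoK K0 (set_val f)]) &
         (forall C : set X, compact C -> C `<=` closure (A `\` K0) ->
            discrete_top (set_type (HomeoK C)))]).
Proof.
move=> lcX hX rA sA _ mA acp.
have [lc|] := pselect (forall M : set X, compact M -> metrizable_set M ->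
  locally_compact [set: set_type (HomeoK M)]); first by left.
move=> /existsNP[M /not_implyP[cM /not_implyP[mM nlc]]]; right.
have clA := regular_closed_closed rA.
have [K [Kreg KA Kmono Kexh]] := regular_closed_exhaustion lcX hX rA sA.
have [n nopen] := ACP_relatively_open lcX hX clA mA (fun n => (Kreg n).2) KA
  Kmono Kexh acp cM mM nlc.
(* Enlarging [L] to a member of the exhaustion beyond [n] treats at once the compact sets containing
   [K n] in (1) and those in the closure of [A] minus [K n] in (2). *)
have relopen L : compact L -> L `<=` A -> relatively_open (K n) L.
  move=> cL LA; have [q Lq] := Kexh L cL LA.
  have [W nW WK] := nopen (maxn n q) (leq_maxl n q).
  exists W => // f [Wf Lf]; apply: WK; split=> //; apply: HomeoK_mono Lf.
  by apply: subset_trans Lq _; apply: Kmono; exact: leq_maxr.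
exists (K n); split=> [|||L cL KL LA|C cC CA].
- by have [] := Kreg n.
- by have [] := Kreg n.
- exact: KA.
- by apply: relatively_open_open => //; exact: relopen.
apply/HomeoK_discrete/(relatively_open_frontier hX (Kreg n).1 CA).
apply: relopen => //; apply: subset_trans CA _.
by rewrite [X in _ `<=` X](closure_id A).1 //; apply: closureS; exact: subDsetl.
Qed.
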